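(* Let $p$ be the peak value of the Collatz sequence starting at some positive integer $n$ (assumed to have a maximum), let $u$ be the odd number immediately before $p$ in this sequence, and let $v$ be the odd number immediately after $p$. Suppose $u=2\cdot 4^t k+\frac{4^{t+1}-1}{3}$ with an integer $t\ge 1$ and $k=2l$ for a positive integer $l$. Then: (1) If $l$ is even, then $4^{t+1}\mid p$ and $v=3l+1$. (2) If $l$ is odd, and $e$ is the nonnegative integer with $2^e\mid (3l+1)$ and $2^{e+1}\nmid (3l+1)$, then $2^{2t+e+2}\mid p$ and $v=\frac{3l+1}{2^e}$.
   Context: The Collatz map $T$ on the positive integers is $T(m)=m/2$ if $m$ is even and $T(m)=3m+1$ if $m$ is odd; $T^i$ denotes its $i$-fold iterate. The Collatz sequence starting at $n$ is the infinite sequence $n, T(n), T^2(n),\dots$. Its peak value is the maximum of all its terms. That $u$ is the odd number immediately before $p$ means that $u$ is odd and, for some $i\ge 0$, $T^i(n)=u$ and $T^{i+1}(n)=T(u)=p$. The odd number $v$ immediately after $p$ is the first odd term of the sequence $T(p),T^2(p),\dots$ (equivalently, the odd part of the even number $p$). *)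

(* Defs.v *)
From mathcomp Require Import all_boot.

Set Implicit Arguments.
Unset Strict Implicit.
Unset Printing Implicit Defensive.

(* Positive integers are modelled in [nat]; statements about Collatz sequences
   must assume a positive starting value, since [collatz 0 = 0]. *)
Definition collatz (m : nat) : nat := if odd m then 3 * m + 1 else m %/ 2.

Definition collatz_seq (n i : nat) : nat := iter i collatz n.

(* A sequence without a maximum has no peak value. *)
Definition is_peak (n p : nat) : Prop :=
  (exists i, collatz_seq n i = p) /\ (forall i, collatz_seq n i <= p).

Definition odd_immediately_before (n p u : nat) : Prop :=
  odd u /\ exists i, collatz_seq n i = u /\ collatz_seq n i.+1 = p.

Definition odd_immediately_after (p v : nat) : Prop :=
  odd v /\
  exists2 j, 0 < j &
    collatz_seq p j = v /\ (forall i, 0 < i < j -> ~~ odd (collatz_seq p i)).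

(* Main.v *)
Require Import Defs.
From mathcomp Require Import all_boot.
From mathcomp Require Import zify.

(** The odd number [u = 4 ^ (t + 1) * l + (4 ^ (t + 1) - 1) / 3] is chosen so
    that the constant term of [3 * u + 1] cancels: the next Collatz term is
    [p = 3 * u + 1 = 4 ^ (t + 1) * (3 * l + 1)] ([collatz_step_repunit4]).  Starting
    from [2 ^ a * w] with [w] odd and [a > 0], the map only halves until it
    reaches [w], so the first odd term after [p] is its odd part
    ([odd_immediately_after_odd_part]).  Everything thus reduces to the 2-adic
    valuation [e] of [3 * l + 1]: it is [0] when [l] is even, and in all cases
    [p = 2 ^ (2 * t + e + 2) * v]. *)

Lemma collatz_double m : collatz (2 * m) = m.
Proof. by rewrite /collatz oddM /= mulKn. Qed.

Lemma collatz_seq_pow2 a w i :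
  i <= a -> collatz_seq (2 ^ a * w) i = 2 ^ (a - i) * w.
Proof.
elim: i => [|i IHi] lt_ia; first by rewrite subn0.
rewrite /collatz_seq iterS -/(collatz_seq _ _) IHi 1?ltnW //.
by rewrite -(subnSK lt_ia) expnS -mulnA collatz_double.
Qed.

(** The positivity of [a] is essential: [odd_immediately_after] looks strictly
    beyond its first argument, so an odd starting value is not its own odd
    successor. *)
Lemma odd_immediately_after_odd_part a w v :
  0 < a -> odd w -> odd_immediately_after (2 ^ a * w) v -> v = w.
Proof.
move=> a_gt0 w_odd [v_odd [j j_gt0 [def_v before_j]]].
case: (ltngtP j a) => [lt_ja | lt_aj | eq_ja].
- move: v_odd; rewrite -def_v collatz_seq_pow2 1?ltnW //.
  by rewrite oddM oddX subn_eq0 leqNgt lt_ja.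
- have := before_j a; rewrite a_gt0 lt_aj => /(_ isT).
  by rewrite collatz_seq_pow2 // subnn mul1n w_odd.
- by rewrite -def_v eq_ja collatz_seq_pow2 // subnn mul1n.
Qed.

(** The truncated division is exact because [4 = 1] modulo [3]. *)
Lemma three_mul_repunit4 s : 3 * ((4 ^ s - 1) %/ 3) + 1 = 4 ^ s.
Proof.
have s_dvd : 3 %| 4 ^ s - 1.
  by rewrite -eqn_mod_dvd ?expn_gt0 // -modnXm exp1n.
by rewrite mulnC divnK // subnK ?expn_gt0.
Qed.

Lemma collatz_step_repunit4 t l :
  3 * (2 * 4 ^ t * (2 * l) + (4 ^ (t + 1) - 1) %/ 3) + 1
  = 4 ^ (t + 1) * (3 * l + 1).
Proof.
rewrite mulnDr -addnA three_mul_repunit4 addn1 expnS.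
nia.
Qed.

(** The common form of the two cases: the even case is [e = 0]. *)
Lemma odd_after_pow4_mul p v t m e :
  p = 4 ^ (t + 1) * m -> odd_immediately_after p v ->
  2 ^ e %| m -> ~~ (2 ^ (e + 1) %| m) ->
  2 ^ (2 * t + e + 2) %| p /\ v = m %/ 2 ^ e.
Proof.
move=> def_p hv /dvdnP[w def_m].
rewrite def_m addn1 expnS dvdn_pmul2r ?expn_gt0 // dvdn2 negbK => w_odd.
have def_p2 : p = 2 ^ (2 * t + e + 2) * w.
  rewrite def_p def_m (mulnC w) mulnA (_ : 4 = 2 ^ 2) // -expnM -expnD.
  by congr (2 ^ _ * w); lia.
rewrite mulnK ?expn_gt0 //; split; first by rewrite def_p2 dvdn_mulr.
apply: (@odd_immediately_after_odd_part (2 * t + e + 2)) => //.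
  by rewrite addn2.
by rewrite -def_p2.
Qed.

Theorem theorem2p19 (n p u v t k l : nat)
    (hn : 0 < n)
    (hp : is_peak n p)
    (hu : odd_immediately_before n p u)
    (hv : odd_immediately_after p v)
    (ht : 1 <= t)
    (hl : 0 < l)
    (hk : k = 2 * l)
    (hut : u = 2 * 4 ^ t * k + (4 ^ (t + 1) - 1) %/ 3) :
  (~~ odd l -> 4 ^ (t + 1) %| p /\ v = 3 * l + 1) /\
  (odd l -> forall e : nat,
     2 ^ e %| 3 * l + 1 -> ~~ (2 ^ (e + 1) %| 3 * l + 1) ->
     2 ^ (2 * t + e + 2) %| p /\ v = (3 * l + 1) %/ 2 ^ e).
Proof.
have def_p : p = 4 ^ (t + 1) * (3 * l + 1).
  have [u_odd [i [def_u <-]]] := hu.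
  rewrite /collatz_seq iterS -/(collatz_seq _ _) def_u /collatz u_odd hut hk.
  exact: collatz_step_repunit4.
split=> [l_even | _ e]; last exact: odd_after_pow4_mul.
split; first by rewrite def_p dvdn_mulr.
have [||_ ->] := @odd_after_pow4_mul p v t _ 0 def_p hv; last by rewrite divn1.
- exact: dvd1n.
- by rewrite dvdn2 addn1 /= oddM /= negbK.
Qed.
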